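(* Let $(\mathcal{Q},\|\cdot\|_{\mathcal{Q}})$ and $(\mathcal{R},\|\cdot\|_{\mathcal{R}})$ be normed (Banach) polynomial ideals (polynomial hyper-ideals). Then: (a) $(\mathcal{Q}^{inj},\|\cdot\|_{\mathcal{Q}^{inj}})$ is a normed (Banach) polynomial ideal (polynomial hyper-ideal). (b) If $\mathcal{Q}\subseteq\mathcal{R}$ and $\|\cdot\|_{\mathcal{R}}\le\|\cdot\|_{\mathcal{Q}}$ (on $\mathcal{Q}$), then $\mathcal{Q}^{inj}\subseteq\mathcal{R}^{inj}$ and $\|\cdot\|_{\mathcal{R}^{inj}}\le\|\cdot\|_{\mathcal{Q}^{inj}}$ (on $\mathcal{Q}^{inj}$). (c) $(\mathcal{Q}^{inj})^{inj}=\mathcal{Q}^{inj}$ and $\|\cdot\|_{(\mathcal{Q}^{inj})^{inj}}=\|\cdot\|_{\mathcal{Q}^{inj}}$. (d) $\mathcal{Q}\subseteq\mathcal{Q}^{inj}$ and $\|\cdot\|_{\mathcal{Q}^{inj}}\le\|\cdot\|_{\mathcal{Q}}$ (on $\mathcal{Q}$).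
   Context: All Banach spaces are over $\mathbb{K}=\mathbb{R}$ or $\mathbb{C}$. For Banach spaces $E,F$ and $m\in\mathbb{N}$, $\mathcal{L}(E;F)$ is the space of bounded linear operators and $\mathcal{P}(^mE;F)$ the space of continuous $m$-homogeneous polynomials from $E$ to $F$, with the usual sup norm over the closed unit ball. Polynomials of finite type are the finite sums $x\mapsto\sum_i \varphi_i(x)^m y_i$ with $\varphi_i\in E^*$, $y_i\in F$. A polynomial ideal is a class $\mathcal{Q}$ of continuous homogeneous polynomials between Banach spaces such that each component $\mathcal{Q}(^mE;F):=\mathcal{P}(^mE;F)\cap\mathcal{Q}$ is a linear subspace of $\mathcal{P}(^mE;F)$ containing the polynomials of finite type, and $t\circ P\circ u\in\mathcal{Q}(^mE;H)$ whenever $t\in\mathcal{L}(G;H)$, $P\in\mathcal{Q}(^mF;G)$, $u\in\mathcal{L}(E;F)$. It is a polynomial hyper-ideal if $t\circ P\circ Q\in\mathcal{Q}(^{mn}E;H)$ whenever $t\in\mathcal{L}(G;H)$, $P\in\mathcal{Q}(^mF;G)$, $Q\in\mathcal{P}(^nE;F)$. Let $\|\cdot\|_{\mathcal{Q}}\colon\mathcal{Q}\to\mathbb{R}$ restrict to a norm on each component and satisfy $\|\lambda\in\mathbb{K}\mapsto\lambda^m\|_{\mathcal{Q}}=1$ for every $m$. Then $(\mathcal{Q},\|\cdot\|_{\mathcal{Q}})$ is a normed polynomial ideal if $\|t\circ P\circ u\|_{\mathcal{Q}}\le\|t\|\cdot\|P\|_{\mathcal{Q}}\cdot\|u\|^m$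 for $t,P,u$ as in the ideal condition; it is a normed polynomial hyper-ideal if $\|t\circ P\circ Q\|_{\mathcal{Q}}\le\|t\|\cdot\|P\|_{\mathcal{Q}}\cdot\|Q\|^m$ for $t,P,Q$ as in the hyper-ideal condition. It is Banach if every component $(\mathcal{Q}(^mE;F),\|\cdot\|_{\mathcal{Q}})$ is a Banach space. Canonical metric injection: $I_F\colon F\to\ell_\infty(B_{F^*})$, $I_F(y)=(\varphi(y))_{\varphi\in B_{F^*}}$, where $B_{F^*}$ is the closed unit ball of $F^*$ and $\ell_\infty(B_{F^*})$ is the space of bounded scalar functions on $B_{F^*}$ with the sup norm. Injective hull: $\mathcal{Q}^{inj}(^mE;F)=\{P\in\mathcal{P}(^mE;F): I_F\circ P\in\mathcal{Q}(^mE;\ell_\infty(B_{F^*}))\}$ with $\|P\|_{\mathcal{Q}^{inj}}:=\|I_F\circ P\|_{\mathcal{Q}}$. *)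

(* Defs.v *)
Set Warnings "-notation-overridden,-ambiguous-paths".
From Stdlib Require Import Reals Lra ClassicalEpsilon FunctionalExtensionality
  PropExtensionality ProofIrrelevance.
From Coquelicot Require Import Coquelicot.
From mathcomp Require Import ssreflect ssrfun ssrbool eqtype ssrnat fintype.

Set Implicit Arguments.
Unset Strict Implicit.
Unset Printing Implicit Defensive.

Local Open Scope R_scope.

Variant scalars := RealScalars | ComplexScalars.

Definition scalar_field (k : scalars) : AbsRing :=
  match k with
  | RealScalars => R_AbsRing
  | ComplexScalars => C_AbsRing
  end.

Coercion scalar_field : scalars >-> AbsRing.

Definition Banach (K : scalars) := CompleteNormedModule K.

(* Coquelicot's uniform structure on [C] is the one of the product [R * R],
   which is only equivalent to the one given by the modulus, hence the
   conversion below. *)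
Lemma C_complete_abs (F : (C -> Prop) -> Prop) :
  ProperFilter F ->
  @cauchy (AbsRing_UniformSpace C_AbsRing) F ->
  forall eps : posreal,
    F (@ball (AbsRing_UniformSpace C_AbsRing) (C_complete_lim F) eps).
Proof.
move=> HF cF eps.
have cF' : @cauchy C_UniformSpace F.
  move=> e; case: (cF e) => x Fx; exists x.
  apply: filter_imp Fx => y; exact: (@norm_compat1 _ C_NormedModule).
have nf0 := @norm_factor_gt_0 _ C_NormedModule.
have e'0 : 0 < eps / @norm_factor _ C_NormedModule.
  by apply: Rdiv_lt_0_compat => //; exact: cond_pos.
have := C_complete_ax1 _ HF cF' (mkposreal _ e'0).
apply: filter_imp => y /(@norm_compat2 _ C_NormedModule) /= H.
rewrite /ball /= /AbsRing_ball.
replace (pos eps) with (@norm_factor _ C_NormedModule *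
  (eps / @norm_factor _ C_NormedModule)); first exact: H.
field; lra.
Qed.

Lemma C_close_abs (F1 F2 : (C -> Prop) -> Prop) :
  filter_le F1 F2 -> filter_le F2 F1 ->
  @close (AbsRing_UniformSpace C_AbsRing) (C_complete_lim F1)
    (C_complete_lim F2).
Proof.
move=> H1 H2.
have -> : F1 = F2.
  apply: functional_extensionality => P.
  by apply: propositional_extensionality; split; [apply: H2 | apply: H1].
move=> eps; exact: ball_center.
Qed.

Definition scalar_complete (K : scalars) :
    CompleteSpace.mixin_of (AbsRing_UniformSpace K) :=
  match K with
  | RealScalars => R_CompleteSpace_mixin
  | ComplexScalars =>
      @CompleteSpace.Mixin (AbsRing_UniformSpace C_AbsRing) C_complete_lim
        C_complete_abs C_close_abs
  end.

(* The scalar field as a Banach space over itself. Its carrier is convertible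
   to that of [scalar_field K], and its norm is the absolute value. *)
Definition line (K : scalars) : Banach K :=
  CompleteNormedModule.Pack K K
    (CompleteNormedModule.Class K K
      (NormedModule.class K (AbsRing_NormedModule K)) (scalar_complete K)) K.

(* The supremum of the norm over the closed unit ball, used for operators,
   functionals and polynomials alike. It is the true supremum whenever [f] is
   bounded on the ball. *)
Definition sup_norm (K : scalars) (E F : Banach K) (f : E -> F) : R :=
  real (Lub_Rbar (fun r => exists x : E, norm x <= 1 /\ r = norm (f x))).

Section BoundedFunctions.
Context (K : scalars) (S : Type).

Definition linf : Type :=
  {f : S -> K | exists M : R, forall s, abs (f s) <= M}.

Definition linf_val (f : linf) : S -> K := proj1_sig f.
Coercion linf_val : linf >-> Funclass.

Lemma linf_ext (f g : linf) : (forall s, f s = g s) -> f = g.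
Proof.
case: f g => [f Hf] [g Hg] /= H.
move: Hf Hg; have -> : f = g by apply: functional_extensionality.
by move=> Hf Hg; rewrite (proof_irrelevance _ Hf Hg).
Qed.

Lemma linf_plus_bounded (f g : linf) :
  exists M : R, forall s, abs (plus (f s) (g s)) <= M.
Proof.
case: (proj2_sig f) (proj2_sig g) => [M HM] [N HN].
exists (M + N) => s; apply: Rle_trans (abs_triangle _ _) _.
exact: Rplus_le_compat.
Qed.

Lemma linf_zero_bounded : exists M : R, forall s : S, abs (zero : K) <= M.
Proof. by exists 0 => s; rewrite abs_zero; apply: Rle_refl. Qed.

Lemma linf_opp_bounded (f : linf) :
  exists M : R, forall s, abs (opp (f s)) <= M.
Proof. by case: (proj2_sig f) => M HM; exists M => s; rewrite abs_opp. Qed.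

Lemma linf_scal_bounded (l : K) (f : linf) :
  exists M : R, forall s, abs (mult l (f s)) <= M.
Proof.
case: (proj2_sig f) => M HM; exists (abs l * M) => s.
apply: Rle_trans (abs_mult _ _) _.
by apply: Rmult_le_compat_l (HM s); apply: abs_ge_0.
Qed.

Definition linf_plus (f g : linf) : linf := exist _ _ (linf_plus_bounded f g).
Definition linf_zero : linf := exist _ _ linf_zero_bounded.
Definition linf_opp (f : linf) : linf := exist _ _ (linf_opp_bounded f).
Definition linf_scal (l : K) (f : linf) : linf :=
  exist _ _ (linf_scal_bounded l f).

Lemma linf_plus_comm f g : linf_plus f g = linf_plus g f.
Proof. by apply: linf_ext => s; apply: plus_comm. Qed.
Lemma linf_plus_assoc f g h :
  linf_plus f (linf_plus g h) = linf_plus (linf_plus f g) h.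
Proof. by apply: linf_ext => s; apply: plus_assoc. Qed.
Lemma linf_plus_zero_r f : linf_plus f linf_zero = f.
Proof. by apply: linf_ext => s; apply: plus_zero_r. Qed.
Lemma linf_plus_opp_r f : linf_plus f (linf_opp f) = linf_zero.
Proof. by apply: linf_ext => s; apply: plus_opp_r. Qed.

Definition linf_AbelianMonoid_mixin :=
  AbelianMonoid.Mixin linf linf_plus linf_zero
    linf_plus_comm linf_plus_assoc linf_plus_zero_r.
Canonical linf_AbelianMonoid :=
  AbelianMonoid.Pack linf linf_AbelianMonoid_mixin linf.

Definition linf_AbelianGroup_mixin :=
  AbelianGroup.Mixin linf_AbelianMonoid linf_opp linf_plus_opp_r.
Canonical linf_AbelianGroup :=
  AbelianGroup.Pack linf
    (AbelianGroup.Class linf linf_AbelianMonoid_mixin linf_AbelianGroup_mixin)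
    linf.

Lemma linf_scal_assoc (x y : K) (f : linf) :
  linf_scal x (linf_scal y f) = linf_scal (mult x y) f.
Proof. by apply: linf_ext => s; apply: mult_assoc. Qed.
Lemma linf_scal_one (f : linf) : linf_scal one f = f.
Proof. by apply: linf_ext => s; apply: mult_one_l. Qed.
Lemma linf_scal_distr_l (x : K) (f g : linf) :
  linf_scal x (plus f g) = plus (linf_scal x f) (linf_scal x g).
Proof. by apply: linf_ext => s; apply: mult_distr_l. Qed.
Lemma linf_scal_distr_r (x y : K) (f : linf) :
  linf_scal (plus x y) f = plus (linf_scal x f) (linf_scal y f).
Proof. by apply: linf_ext => s; apply: mult_distr_r. Qed.

Definition linf_ModuleSpace_mixin :=
  ModuleSpace.Mixin K linf_AbelianGroup linf_scal
    linf_scal_assoc linf_scal_one linf_scal_distr_l linf_scal_distr_r.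
Canonical linf_ModuleSpace :=
  ModuleSpace.Pack K linf
    (ModuleSpace.Class K linf (AbelianGroup.class linf_AbelianGroup)
      linf_ModuleSpace_mixin) linf.

Definition linf_norm (f : linf) : R :=
  real (Lub_Rbar (fun r => exists s, r = abs (f s))).

Lemma linf_norm_ge (f : linf) s : abs (f s) <= linf_norm f.
Proof.
rewrite /linf_norm /Lub_Rbar; case: ex_lub_Rbar => l [ub lub] /=.
have Hs : Rbar_le (abs (f s)) l by apply: ub; exists s.
case: (proj2_sig f) => M HM.
have HM' : Rbar_le l M by apply: lub => _ [t ->]; apply: HM.
by case: l Hs HM' {ub lub}.
Qed.

Lemma linf_norm_le (f : linf) M :
  0 <= M -> (forall s, abs (f s) <= M) -> linf_norm f <= M.
Proof.
move=> M0 HM; rewrite /linf_norm /Lub_Rbar.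
case: ex_lub_Rbar => l [ub lub] /=.
have HM' : Rbar_le l M by apply: lub => _ [t ->]; apply: HM.
by case: l HM' {ub lub}.
Qed.

Lemma linf_norm_ge0 (f : linf) : 0 <= linf_norm f.
Proof.
case: (excluded_middle_informative (inhabited S)) => [[s]|nS].
  exact: Rle_trans (abs_ge_0 _) (linf_norm_ge f s).
rewrite /linf_norm (_ : Lub_Rbar _ = m_infty); first exact: Rle_refl.
apply: is_lub_Rbar_unique; split=> [r [s _]|b _]; last by case: b.
by case: nS; split.
Qed.

Lemma linf_norm_triangle (f g : linf) :
  linf_norm (plus f g) <= linf_norm f + linf_norm g.
Proof.
apply: linf_norm_le => [|s].
  by apply: Rplus_le_le_0_compat; apply: linf_norm_ge0.
apply: Rle_trans (abs_triangle _ _) _.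
by apply: Rplus_le_compat; apply: linf_norm_ge.
Qed.

Lemma linf_norm_scal (l : K) (f : linf) :
  linf_norm (scal l f) <= abs l * linf_norm f.
Proof.
apply: linf_norm_le => [|s].
  by apply: Rmult_le_pos; [apply: abs_ge_0 | apply: linf_norm_ge0].
apply: Rle_trans (abs_mult _ _) _.
by apply: Rmult_le_compat_l; [apply: abs_ge_0 | apply: linf_norm_ge].
Qed.

Lemma linf_norm_eq0 (f : linf) : linf_norm f = 0 -> f = zero.
Proof.
move=> f0; apply: linf_ext => s; apply: abs_eq_zero.
apply: Rle_antisym; last exact: abs_ge_0.
by rewrite -f0; apply: linf_norm_ge.
Qed.

Definition linf_ball (f : linf) (eps : R) (g : linf) :=
  linf_norm (minus g f) < eps.

Lemma linf_ball_center (f : linf) (eps : posreal) : linf_ball f eps f.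
Proof.
apply: Rle_lt_trans (cond_pos eps); apply: linf_norm_le (Rle_refl 0) _ => s.
by rewrite minus_eq_zero abs_zero; apply: Rle_refl.
Qed.

Lemma linf_ball_sym (f g : linf) (eps : R) :
  linf_ball f eps g -> linf_ball g eps f.
Proof.
move=> H; apply: Rle_lt_trans H.
apply: linf_norm_le (linf_norm_ge0 _) _ => s.
rewrite -opp_minus; apply: Rle_trans (linf_norm_ge _ s).
by right; exact: abs_opp.
Qed.

Lemma linf_ball_triangle (f g h : linf) (e1 e2 : R) :
  linf_ball f e1 g -> linf_ball g e2 h -> linf_ball f (e1 + e2) h.
Proof.
rewrite /linf_ball => H1 H2; rewrite (minus_trans g).
by apply: Rle_lt_trans (linf_norm_triangle _ _) _; lra.
Qed.

Definition linf_UniformSpace_mixin :=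
  UniformSpace.Mixin linf linf_zero linf_ball
    linf_ball_center linf_ball_sym linf_ball_triangle.
Canonical linf_UniformSpace :=
  UniformSpace.Pack linf linf_UniformSpace_mixin linf.

Canonical linf_NormedModuleAux :=
  NormedModuleAux.Pack K linf
    (NormedModuleAux.Class K linf (ModuleSpace.class K linf_ModuleSpace)
      linf_UniformSpace_mixin) linf.

Lemma linf_norm_ball (f g : linf) (eps : posreal) :
  ball f eps g -> linf_norm (minus g f) < 1 * eps.
Proof. by rewrite Rmult_1_l. Qed.

Definition linf_NormedModule_mixin :=
  NormedModule.Mixin K linf_NormedModuleAux linf_norm 1
    linf_norm_triangle linf_norm_scal (fun _ _ _ H => H) linf_norm_ball
    linf_norm_eq0.
Canonical linf_NormedModule :=
  NormedModule.Pack K linf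
    (NormedModule.Class K linf (NormedModuleAux.class K linf_NormedModuleAux)
      linf_NormedModule_mixin) linf.

Definition linf_lim (F : (linf -> Prop) -> Prop) : linf :=
  epsilon (inhabits linf_zero) (fun f => forall eps : posreal, F (ball f eps)).

Lemma linf_complete (F : (linf -> Prop) -> Prop) :
  ProperFilter F -> cauchy F ->
  forall eps : posreal, F (ball (linf_lim F) eps).
Proof.
move=> HF cF; apply: (epsilon_spec (inhabits linf_zero)
  (fun f => forall eps : posreal, F (ball f eps))).
pose T := CompleteSpace.Pack K
  (CompleteSpace.Class K (AbsRing_UniformSpace_mixin K) (scalar_complete K)) K.
pose G (P : (S -> K) -> Prop) := F (fun f => P f).
have HG : ProperFilter G.
  split=> [P GP|]; first by case: (filter_ex _ GP) => f; exists f.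
  split; first exact: filter_true.
  - by move=> P Q; apply: filter_and.
  - by move=> P Q PQ; apply: filter_imp => f; apply: PQ.
have cG (eps : posreal) : exists f : S -> T, G (@ball (fct_UniformSpace S T) f eps).
  case: (cF eps) => f Ff; exists (linf_val f).
  change (F (fun g => forall s, abs (minus (g s) (linf_val f s)) < eps)).
  apply: filter_imp Ff => g fg s.
  change (abs (linf_val (minus g f) s) < eps).
  exact: Rle_lt_trans (linf_norm_ge (minus g f) s) fg.
pose g : S -> K := @lim_fct S T G.
have Glim (eps : posreal) :
    F (fun f => forall s, abs (minus (linf_val f s) (g s)) < eps).
  exact: (@complete_cauchy_fct S T G HG cG eps).
have gb : exists M : R, forall s, abs (g s) <= M.
  case: (filter_ex _ (Glim (mkposreal 1 Rlt_0_1))) => f fg.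
  exists (1 + linf_norm f) => s.
  have -> : (g s) = plus (opp (minus (f s) (g s))) (f s).
    by rewrite opp_minus /minus -plus_assoc plus_opp_l plus_zero_r.
  apply: Rle_trans (abs_triangle _ _) _; rewrite abs_opp.
  by apply: Rplus_le_compat (linf_norm_ge f s); apply: Rlt_le; apply: fg.
exists (exist (fun f : S -> K => exists M : R, forall s, abs (f s) <= M) g gb).
move=> eps.
have := Glim (pos_div_2 eps); apply: filter_imp => f fg.
apply: (@Rle_lt_trans _ (eps / 2)); last by have := cond_pos eps; lra.
apply: linf_norm_le => [|s]; first by have := cond_pos eps; lra.
by apply: Rlt_le; apply: fg.
Qed.

Lemma linf_close_lim (F1 F2 : (linf -> Prop) -> Prop) :
  filter_le F1 F2 -> filter_le F2 F1 -> close (linf_lim F1) (linf_lim F2).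
Proof.
move=> H1 H2; have -> : F1 = F2.
  apply: functional_extensionality => P.
  by apply: propositional_extensionality; split; [apply: H2 | apply: H1].
move=> eps; exact: ball_center.
Qed.

Definition linf_CompleteSpace_mixin :=
  CompleteSpace.Mixin linf_UniformSpace linf_lim linf_complete linf_close_lim.
Canonical linf_CompleteSpace :=
  CompleteSpace.Pack linf
    (CompleteSpace.Class linf linf_UniformSpace_mixin linf_CompleteSpace_mixin)
    linf.
Canonical linf_CompleteNormedModule : Banach K :=
  CompleteNormedModule.Pack K linf
    (CompleteNormedModule.Class K linf (NormedModule.class K linf_NormedModule)
      linf_CompleteSpace_mixin) linf.

End BoundedFunctions.

Section CanonicalInjection.
Context (K : scalars) (F : Banach K).

Definition dual_ball : Type :=
  {phi : F -> line K | is_linear phi /\ sup_norm phi <= 1}.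

Lemma dual_ball_unit (phi : dual_ball) (y : F) :
  norm y <= 1 -> norm (proj1_sig phi y) <= 1.
Proof.
case: phi => phi [lphi nphi] /= y1; apply: Rle_trans nphi.
rewrite /sup_norm /Lub_Rbar; case: ex_lub_Rbar => l [ub lub] /=.
have Hy : Rbar_le (norm (phi y)) l by apply: ub; exists y.
case: (linear_norm _ lphi) => M [M0 HM].
have HM' : Rbar_le l M.
  apply: lub => _ [x [x1 ->]]; apply: Rle_trans (HM x) _.
  by rewrite -[X in _ <= X]Rmult_1_r; apply: Rmult_le_compat_l => //; lra.
by case: l Hy HM' {ub lub}.
Qed.

Lemma scalar_of_pos (r : R) : 0 < r ->
  exists a b : K, abs a = r /\ abs b = / r /\ mult a b = one.
Proof.
move=> r0; have ir0 := Rinv_0_lt_compat _ r0.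
case: K; [exists r, (/ r) | exists (RtoC r), (RtoC (/ r))]; rewrite /abs /=.
  rewrite !Rabs_pos_eq; try lra; do 2 split=> //.
  rewrite /mult /one /=; field; lra.
rewrite !Cmod_R !Rabs_pos_eq; try lra; do 2 split=> //.
rewrite /mult /one /= -RtoC_mult; congr RtoC; field; lra.
Qed.

Lemma dual_ball_le (phi : dual_ball) (y : F) :
  abs (proj1_sig phi y : K) <= norm y.
Proof.
case: (Rle_lt_or_eq_dec _ _ (norm_ge_0 y)) => [y0|y0]; last first.
  have -> : y = zero by apply: norm_eq_zero.
  rewrite norm_zero; have [lphi _] := proj2_sig phi.
  case: (linear_norm _ lphi) => M [_ /(_ zero)].
  by rewrite norm_zero Rmult_0_r.
case: (scalar_of_pos y0) => a [b [aa [ab ab1]]].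
have u1 : norm (scal b y) <= 1.
  apply: Rle_trans (norm_scal _ _) _; rewrite ab Rinv_l; lra.
have := dual_ball_unit phi u1.
have {2}-> : y = scal a (scal b y) by rewrite scal_assoc ab1 scal_one.
have [lphi _] := proj2_sig phi.
rewrite (linear_scal _ lphi a) => H.
apply: Rle_trans (abs_mult a _) _; rewrite aa.
rewrite -[X in _ <= X]Rmult_1_r.
by apply: Rmult_le_compat_l H; apply: norm_ge_0.
Qed.

Lemma inj_bounded (y : F) :
  exists M : R, forall phi : dual_ball, abs (proj1_sig phi y : K) <= M.
Proof. by exists (norm y) => phi; apply: dual_ball_le. Qed.

Definition linf_dual : Banach K := linf_CompleteNormedModule K dual_ball.

Definition canonical_inj (y : F) : linf_dual :=
  exist _ (fun phi : dual_ball => proj1_sig phi y : K) (inj_bounded y).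

End CanonicalInjection.

Section Polynomials.
Context (K : scalars) (E F : Banach K).

Definition update m (x : 'I_m -> E) (i : 'I_m) (u : E) : 'I_m -> E :=
  fun j => if j == i then u else x j.

Definition multilinear m (A : ('I_m -> E) -> F) : Prop :=
  forall (x : 'I_m -> E) (i : 'I_m) (a : K) (u v : E),
    A (update x i (plus (scal a u) v)) =
    plus (scal a (A (update x i u))) (A (update x i v)).

Definition hpoly (m : nat) (P : E -> F) : Prop :=
  (exists A : ('I_m -> E) -> F,
     multilinear A /\ forall x, P x = A (fun _ => x)) /\
  (forall x, continuous P x).

Definition finite_type (m : nat) (P : E -> F) : Prop :=
  exists (n : nat) (phi : nat -> E -> line K) (y : nat -> F),
    (forall i, is_linear (phi i)) /\
    forall x, P x = sum_n (fun i => scal (pow_n (phi i x : K) m) (y i)) n.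

End Polynomials.

(* A class of polynomials is a predicate on all maps between Banach spaces,
   and a norm on it a real-valued function whose values outside the class are
   irrelevant. Degrees of homogeneity are positive. *)

Definition poly_class (K : scalars) :=
  forall E F : Banach K, (E -> F) -> Prop.
Definition poly_norm (K : scalars) :=
  forall E F : Banach K, (E -> F) -> R.

Section Ideals.
Context (K : scalars).
Implicit Types (Q : poly_class K) (N : poly_norm K).

(* The component of degree [m]: the maps in [Q] that are continuous
   [m]-homogeneous polynomials. The zero map is in every component. *)
Definition component Q (m : nat) (E F : Banach K) (P : E -> F) : Prop :=
  hpoly m P /\ Q E F P.

Record polynomial_ideal Q : Prop := {
  ideal_hpoly : forall (E F : Banach K) (P : E -> F),
    Q E F P -> exists m, (0 < m)%N /\ hpoly m P;
  ideal_zero : forall m (E F : Banach K), (0 < m)%N ->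
    component Q m (fun _ : E => zero : F);
  ideal_plus : forall m (E F : Banach K) (P1 P2 : E -> F), (0 < m)%N ->
    component Q m P1 -> component Q m P2 ->
    component Q m (fun x => plus (P1 x) (P2 x));
  ideal_scal : forall m (E F : Banach K) (a : K) (P : E -> F), (0 < m)%N ->
    component Q m P -> component Q m (fun x => scal a (P x));
  ideal_finite_type : forall m (E F : Banach K) (P : E -> F), (0 < m)%N ->
    finite_type m P -> component Q m P;
  ideal_comp : forall m (E F G H : Banach K)
      (t : G -> H) (P : F -> G) (u : E -> F), (0 < m)%N ->
    is_linear t -> component Q m P -> is_linear u ->
    component Q m (fun x => t (P (u x))) }.

Definition polynomial_hyper_ideal Q : Prop :=
  polynomial_ideal Q /\
  forall m n (E F G H : Banach K) (t : G -> H) (P : F -> G) (S : E -> F),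
    (0 < m)%N -> (0 < n)%N ->
    is_linear t -> component Q m P -> hpoly n S ->
    component Q (m * n)%N (fun x => t (P (S x))).

Record ideal_norm Q N : Prop := {
  ideal_norm_ge0 : forall m (E F : Banach K) (P : E -> F), (0 < m)%N ->
    component Q m P -> 0 <= N E F P;
  ideal_norm_eq0 : forall m (E F : Banach K) (P : E -> F), (0 < m)%N ->
    component Q m P -> N E F P = 0 -> forall x, P x = zero;
  ideal_norm_scal : forall m (E F : Banach K) (a : K) (P : E -> F),
    (0 < m)%N -> component Q m P ->
    N E F (fun x => scal a (P x)) = abs a * N E F P;
  ideal_norm_triangle : forall m (E F : Banach K) (P1 P2 : E -> F),
    (0 < m)%N -> component Q m P1 -> component Q m P2 ->
    N E F (fun x => plus (P1 x) (P2 x)) <= N E F P1 + N E F P2;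
  ideal_norm_power : forall m, (0 < m)%N ->
    N (line K) (line K) (fun a => pow_n (a : K) m) = 1 }.

Definition normed_polynomial_ideal Q N : Prop :=
  polynomial_ideal Q /\ ideal_norm Q N /\
  forall m (E F G H : Banach K) (t : G -> H) (P : F -> G) (u : E -> F),
    (0 < m)%N -> is_linear t -> component Q m P -> is_linear u ->
    N E H (fun x => t (P (u x))) <= sup_norm t * N F G P * sup_norm u ^ m.

Definition normed_polynomial_hyper_ideal Q N : Prop :=
  polynomial_hyper_ideal Q /\ ideal_norm Q N /\
  forall m n (E F G H : Banach K) (t : G -> H) (P : F -> G) (S : E -> F),
    (0 < m)%N -> (0 < n)%N ->
    is_linear t -> component Q m P -> hpoly n S ->
    N E H (fun x => t (P (S x))) <= sup_norm t * N F G P * sup_norm S ^ m.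

Definition complete_components Q N : Prop :=
  forall m (E F : Banach K) (P : nat -> E -> F), (0 < m)%N ->
    (forall i, component Q m (P i)) ->
    (forall eps : posreal, exists i0 : nat, forall i j : nat,
       (i0 <= i)%N -> (i0 <= j)%N ->
       N E F (fun x => minus (P i x) (P j x)) < eps) ->
    exists P0 : E -> F, component Q m P0 /\
      is_lim_seq (fun i => N E F (fun x => minus (P i x) (P0 x))) 0.

(* The class whose components are the [Q^inj(^m E; F)]. *)
Definition inj_hull Q : poly_class K :=
  fun E F P => exists m, (0 < m)%N /\ hpoly m P /\
    component Q m (fun x => canonical_inj (P x)).

Definition inj_norm N : poly_norm K :=
  fun E F P => N E (linf_dual F) (fun x => canonical_inj (P x)).

Definition class_sub Q1 Q2 : Prop :=
  forall (E F : Banach K) (P : E -> F), Q1 E F P -> Q2 E F P.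

Definition class_eq Q1 Q2 : Prop :=
  forall (E F : Banach K) (P : E -> F), Q1 E F P <-> Q2 E F P.

Definition norm_le_on Q N1 N2 : Prop :=
  forall (E F : Banach K) (P : E -> F), Q E F P -> N1 E F P <= N2 E F P.

Definition norm_eq_on Q N1 N2 : Prop :=
  forall (E F : Banach K) (P : E -> F), Q E F P -> N1 E F P = N2 E F P.

End Ideals.

Variant ideal_kind :=
  | NormedIdeal | BanachIdeal | NormedHyperIdeal | BanachHyperIdeal.

Definition is_ideal_of_kind (kind : ideal_kind) (K : scalars)
    (Q : poly_class K) (N : poly_norm K) : Prop :=
  match kind with
  | NormedIdeal => normed_polynomial_ideal Q N
  | BanachIdeal => normed_polynomial_ideal Q N /\ complete_components Q N
  | NormedHyperIdeal => normed_polynomial_hyper_ideal Q N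
  | BanachHyperIdeal =>
      normed_polynomial_hyper_ideal Q N /\ complete_components Q N
  end.

(* Main.v *)
(* Everything is transferred along the canonical injection I_F.  By Hahn-Banach
   it is isometric, and it has a linear left inverse, possibly discontinuous;
   hence P is a continuous m-homogeneous polynomial iff I_F o P is, so the
   degree-m component of Q^inj is exactly {P | I_F o P in Q}.

   The extensions needed for the ideal property are explicit: for t : G -> H and
   c = |t|, the operator (L f)(psi) = c f(psi o t / c) satisfies
   L o I_G = I_H o t and |L| <= |t|.  Likewise evaluations give a norm-one
   retraction of I_F when F = l_inf(S), which yields idempotence, and when F = K,
   which yields the norm of the powers.

   For completeness, composing with a line and with evaluations gives
   |P x| <= |P|_Q |x|^m for P in Q with values in l_inf(S), so a limit in Q of
   the I_F o P_i is a pointwise limit; it takes values in the closed range of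
   I_F and therefore factors through I_F. *)
Set Warnings "-notation-overridden,-ambiguous-paths".
Require Import Defs.
From Stdlib Require Import Reals Lra ClassicalEpsilon FunctionalExtensionality.
From Coquelicot Require Import Coquelicot.
From mathcomp Require Import ssreflect ssrfun ssrbool eqtype ssrnat fintype.
From mathcomp Require classical_sets.

Set Implicit Arguments.
Unset Strict Implicit.
Unset Printing Implicit Defensive.

Local Open Scope R_scope.

(** * Extension of linear maps by Zorn's lemma, and the real Hahn-Banach theorem *)

Record subspace (K : Ring) (V : ModuleSpace K) (G : V -> Prop) : Prop := {
  subspace_zero : G zero;
  subspace_plus : forall x y, G x -> G y -> G (plus x y);
  subspace_scal : forall a x, G x -> G (scal a x) }.

(* Linear maps are handled through their graphs. The set [D] is a pointwise
   constraint that a graph must satisfy; it also forces single-valuedness. *)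
Lemma linear_extension (K : Ring) (V W : ModuleSpace K) (D G0 : V * W -> Prop) :
  (forall w, D (zero, w) -> w = zero) ->
  subspace G0 -> (forall p, G0 p -> D p) ->
  (forall (G : V * W -> Prop) v, subspace G -> (forall p, G p -> D p) ->
     exists w, forall p a, G p -> D (plus p (scal a (v, w)))) ->
  exists f : V -> W,
    (forall x y, f (plus x y) = plus (f x) (f y)) /\
    (forall a x, f (scal a x) = scal a (f x)) /\
    (forall p, G0 p -> f (fst p) = snd p) /\
    forall x, D (x, f x).
Proof.
move=> D0 sG0 G0D step.
pose adm (G : V * W -> Prop) :=
  subspace G /\ (forall p, G0 p -> G p) /\ (forall p, G p -> D p).
(* The union of the empty chain is empty and so not a subspace; the first disjunct admits it. An
   empty set is not maximal, since [G0] contains zero. *)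
have [|G [[Gempty|[sG [G0G GD]]] Gmax]] :=
  @classical_sets.Zorn_bigcup (V * W) (fun G => (forall p, ~ G p) \/ adm G).
- move=> C CP Ctot.
  case: (excluded_middle_informative (exists X, C X /\ adm X)); last first.
    move=> nC; left=> p [X CX Xp]; case: (CP X CX) => [/(_ p)//|aX].
    by apply: nC; exists X.
  case=> X [CX [sX [G0X XD]]]; right; split; [split|split].
  + by exists X => //; apply: subspace_zero sX.
  + move=> x y [Y CY Yx] [Z CZ Zy].
    have aT T z : C T -> T z -> adm T by move=> CT Tz; case: (CP T CT) => // /(_ z).
    case: (Ctot Y Z CY CZ) => H.
      exists Z => //; apply: subspace_plus (proj1 (aT _ _ CZ Zy)) _ _ _ Zy.
      exact: H.
    exists Y => //; apply: subspace_plus (proj1 (aT _ _ CY Yx)) _ _ Yx _.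
    exact: H.
  + move=> a x [Y CY Yx]; exists Y => //.
    by case: (CP Y CY) => [/(_ x)//|[sY _]]; apply: subspace_scal.
  + by move=> p G0p; exists X => //; apply: G0X.
  + move=> p [Y CY Yp].
    by case: (CP Y CY) => [/(_ p)//|[_ [_ YD]]]; apply: YD.
- exfalso; apply: (Gmax G0); last by right; split.
  split=> [p /Gempty//|H]; exact: Gempty (H _ (subspace_zero sG0)).
(* If the pair [(v, w)] supplied by [step] were outside [G], adding the line it spans would
   contradict maximality. *)
have Gdom v : exists w, G (v, w).
  case: (step G v sG GD) => w Hw; exists w; apply: NNPP => nG.
  pose G' p := exists q a, G q /\ p = plus q (scal a (v, w)).
  have GG' p : G p -> G' p.
    by move=> Gp; exists p, zero; split=> //; rewrite scal_zero_l plus_zero_r.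
  apply: (Gmax G').
    split=> [p /GG'//|H]; apply: nG; apply: H; exists zero, one; split.
      exact: subspace_zero.
    by rewrite scal_one plus_zero_l.
  right; split; [split|split].
  + by apply: GG'; apply: subspace_zero.
  + move=> _ _ [q [a [Gq ->]]] [r [b [Gr ->]]].
    exists (plus q r), (plus a b); split; first exact: subspace_plus.
    rewrite scal_distr_r -!plus_assoc; congr plus.
    by rewrite !plus_assoc; congr plus; apply: plus_comm.
  + move=> c _ [q [a [Gq ->]]]; exists (scal c q), (mult c a).
    split; first exact: subspace_scal.
    by rewrite scal_distr_l scal_assoc.
  + by move=> p /G0G /GG'.
  + by move=> _ [q [a [Gq ->]]]; apply: Hw.
(* The difference of the two pairs lies over zero, where [D0] allows only the value zero. *)
have Gfun v w w' : G (v, w) -> G (v, w') -> w = w'.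
  move=> Gw Gw'.
  have : G (plus (v, w) (scal (opp one) (v, w'))).
    by apply: subspace_plus => //; apply: subspace_scal.
  rewrite scal_opp_one (_ : plus _ _ = (zero, plus w (opp w'))); last first.
    exact: (f_equal (fun z => (z, plus w (opp w'))) (plus_opp_r v)).
  move=> /GD /D0 H.
  by apply: (plus_reg_r (opp w')); rewrite H plus_opp_r.
pose f v := proj1_sig (constructive_indefinite_description _ (Gdom v)).
have Gf v : G (v, f v) by rewrite /f; case: constructive_indefinite_description.
exists f; split; [|split; [|split]].
- move=> x y; apply: Gfun (Gf _) _.
  exact: subspace_plus sG _ _ (Gf x) (Gf y).
- by move=> a x; apply: Gfun (Gf _) _; apply: subspace_scal sG a _ (Gf x).
- by case=> v w /G0G /=; apply: Gfun.
- by move=> x; apply: GD.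
Qed.

(** This is [linear_extension] with the constraint that [p] dominates absolute values, started from
    the line through [(y, p y)]. *)
Lemma hahn_banach_real (V : ModuleSpace R_Ring) (p : V -> R) (y : V) :
  (forall x, 0 <= p x) ->
  (forall x z, p (plus x z) <= p x + p z) ->
  (forall a x, p (scal a x) <= Rabs a * p x) ->
  exists f : V -> R,
    (forall x z, f (plus x z) = f x + f z) /\
    (forall a x, f (scal a x) = a * f x) /\
    f y = p y /\ forall x, Rabs (f x) <= p x.
Proof.
move=> p0 ptri pscal.
have phom a x : 0 < a -> a * p x <= p (scal a x).
  move=> a0; have ia0 := Rinv_0_lt_compat _ a0.
  have := pscal (/ a) (scal a x).
  rewrite scal_assoc (_ : mult (/ a) a = one); last first.
    exact: Rinv_l (Rgt_not_eq _ _ a0).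
  rewrite scal_one Rabs_pos_eq; last lra.
  move=> /(Rmult_le_compat_l a _ _ (Rlt_le _ _ a0)).
  by rewrite -Rmult_assoc Rinv_r ?Rmult_1_l //; lra.
have pz : p zero = 0.
  apply: Rle_antisym; last exact: p0.
  by have := pscal 0 zero; rewrite scal_zero_r Rabs_R0 Rmult_0_l.
have popp x : p (opp x) = p x.
  have pN z : p (opp z) <= p z.
    have := pscal (opp one) z.
    by rewrite scal_opp_one (_ : Rabs _ = 1) ?Rmult_1_l // Rabs_Ropp Rabs_R1.
  by apply: Rle_antisym => //; rewrite -{1}(opp_opp x).
pose D (q : V * R_ModuleSpace) := Rabs (snd q) <= p (fst q).
pose G0 (q : V * R_ModuleSpace) := exists r : R, q = scal r (y, p y).
case: (@linear_extension R_Ring V R_ModuleSpace D G0).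
- move=> w; rewrite /D /= pz => H; have := Rabs_pos w => ?.
  by apply: (@norm_eq_zero _ R_NormedModule); apply: Rle_antisym.
- split.
  + by exists 0; rewrite (scal_zero_l (K := R_Ring)).
  + move=> _ _ [r ->] [s ->]; exists (r + s).
    by rewrite -(scal_distr_r (K := R_Ring)).
  + by move=> a _ [r ->]; exists (a * r); rewrite scal_assoc.
- move=> _ [r ->]; rewrite /D /=.
  rewrite (_ : scal r (p y) = r * p y) //.
  case: (total_order_T r 0) => [[r0|->]|r0].
  + have := @phom (- r) y; rewrite Rabs_mult (Rabs_pos_eq (p y)) //.
    rewrite Rabs_left //.
    rewrite (_ : scal (- r) y = opp (scal r y)) ?popp; first by apply; lra.
    exact: (scal_opp_l (K := R_Ring)).
  + by rewrite Rmult_0_l Rabs_R0.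
  + rewrite Rabs_mult !Rabs_pos_eq //; last lra.
    exact: phom.
- move=> G v sG GD.
  have GD' x r : G (x, r) -> Rabs r <= p x by move/GD.
  have Gplus x r x' r' : G (x, r) -> G (x', r') -> G (plus x x', r + r').
    exact: (subspace_plus sG).
  have Gscal a x r : G (x, r) -> G (scal a x, a * r).
    exact: (subspace_scal sG).
  (* An admissible value at [v] lies above every [r - p (x - v)] and below every [p (x + v) - r]. By
     [key] the former never exceed the latter, so the supremum of the former qualifies. *)
  pose S t := exists x r, G (x, r) /\ t = r - p (plus x (opp v)).
  have key x r x' r' : G (x, r) -> G (x', r') ->
      r - p (plus x (opp v)) <= p (plus x' v) - r'.
    move=> Gq Gq'.
    have H := Rle_trans _ _ _ (Rle_abs _) (GD' _ _ (Gplus _ _ _ _ Gq Gq')).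
    have := ptri (plus x (opp v)) (plus x' v).
    rewrite (_ : plus (plus _ _) _ = plus x x'); first by lra.
    rewrite -!plus_assoc; congr plus; rewrite (plus_comm x') plus_assoc.
    by rewrite plus_opp_l plus_zero_l.
  have Gz : G (zero, 0) := subspace_zero sG.
  case: (completeness S).
  + exists (p (plus zero v) - 0) => _ [x [r [Gq ->]]].
    exact: key Gq Gz.
  + by exists (0 - p (plus zero (opp v))), zero, 0.
  move=> c [cub club]; exists c.
  have lo x r : G (x, r) -> r - c <= p (plus x (opp v)).
    move=> Gq; suff : r - p (plus x (opp v)) <= c by lra.
    by apply: cub; exists x, r.
  have hi x r : G (x, r) -> r + c <= p (plus x v).
    move=> Gq; suff : c <= p (plus x v) - r by lra.
    by apply: club => _ [x' [r' [Gq' ->]]]; apply: key.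
  (* A nonzero coefficient is reduced to 1 or -1 by dividing the pair by its absolute value. *)
  have main x r a : G (x, r) -> r + a * c <= p (plus x (scal a v)).
    move=> Gq; case: (total_order_T a 0) => [[a0|->]|a0].
    + have na0 : 0 < - a by lra.
      have := lo _ _ (Gscal (/ - a) _ _ Gq).
      move=> /(Rmult_le_compat_l _ _ _ (Rlt_le _ _ na0)) H.
      have := Rle_trans _ _ _ H (phom _ _ na0).
      rewrite scal_distr_l scal_opp_r -scal_opp_l scal_assoc.
      rewrite (_ : opp (- a) = a); last exact: Ropp_involutive.
      rewrite (_ : mult (- a) (/ - a) = one); last first.
        by rewrite /mult /one /=; field; lra.
      rewrite scal_one; apply: Rle_trans; right; field; lra.
    + rewrite scal_zero_l plus_zero_r Rmult_0_l Rplus_0_r.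
      exact: Rle_trans (Rle_abs _) (GD' _ _ Gq).
    + have := hi _ _ (Gscal (/ a) _ _ Gq).
      move=> /(Rmult_le_compat_l _ _ _ (Rlt_le _ _ a0)) H.
      have := Rle_trans _ _ _ H (phom _ _ a0).
      rewrite scal_distr_l scal_assoc.
      rewrite (_ : mult a (/ a) = one); last first.
        by rewrite /mult /one /=; field; lra.
      rewrite scal_one; apply: Rle_trans; right; field; lra.
  move=> [x r] a Gq; change (Rabs (r + a * c) <= p (plus x (scal a v))).
  apply: Rabs_le; split; last exact: main.
  (* The lower bound is [main] for the opposite pair, because [p] is even. *)
  have := main _ _ (- a) (Gscal (opp one) _ _ Gq).
  rewrite scal_opp_one (_ : scal (- a) v = opp (scal a v)); last exact: scal_opp_l.
  rewrite -opp_plus popp (_ : opp one * r = - r); last first.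
    by rewrite /opp /one /=; ring.
  move=> H; suff : - (r + a * c) <= p (plus x (scal a v)) by lra.
  by apply: Rle_trans H; right; ring.
move=> f [fplus [fscal [fG fD]]]; exists f; split=> //; split=> //; split=> //.
apply: (fG (y, p y)); exists 1; rewrite (scal_one (K := R_Ring)) //.
Qed.

(** * Real scalars inside [K], and spaces over [K] regarded as real vector spaces *)

Definition of_real (K : scalars) : R -> K :=
  match K with
  | RealScalars => fun r => r
  | ComplexScalars => RtoC
  end.

Lemma of_real_plus (K : scalars) (a b : R) :
  of_real K (a + b) = plus (of_real K a) (of_real K b).
Proof. by case: K => //; apply: RtoC_plus. Qed.

Lemma of_real_mult (K : scalars) (a b : R) :
  of_real K (a * b) = mult (of_real K a) (of_real K b).
Proof. by case: K => //; apply: RtoC_mult. Qed.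

Lemma of_real_1 (K : scalars) : of_real K 1 = one.
Proof. by case: K. Qed.

Lemma abs_of_real (K : scalars) (a : R) : abs (of_real K a) = Rabs a.
Proof. by case: K => //; apply: Cmod_R. Qed.

Lemma scalar_mult_comm (K : scalars) (a b : K) : mult a b = mult b a.
Proof. by case: K a b => a b; [apply: Rmult_comm | apply: Cmult_comm]. Qed.

Lemma scalar_inv (K : scalars) (a : K) : a <> zero -> exists b, mult b a = one.
Proof.
case: K a => a a0; [exists (/ a) | exists (Cinv a)].
  exact: Rinv_l.
exact: Cinv_l.
Qed.

Section RealRestriction.
Context (K : scalars) (E : ModuleSpace K).

Definition real_scal (a : R_Ring) (x : E) : E := scal (of_real K a) x.

Lemma real_scal_assoc (a b : R_Ring) x :
  real_scal a (real_scal b x) = real_scal (mult a b) x.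
Proof. by rewrite /real_scal scal_assoc -of_real_mult. Qed.

Lemma real_scal_one x : real_scal one x = x.
Proof. by rewrite /real_scal of_real_1 scal_one. Qed.

Lemma real_scal_distr_l a x y :
  real_scal a (plus x y) = plus (real_scal a x) (real_scal a y).
Proof. exact: scal_distr_l. Qed.

Lemma real_scal_distr_r (a b : R_Ring) x :
  real_scal (plus a b) x = plus (real_scal a x) (real_scal b x).
Proof. by rewrite /real_scal of_real_plus scal_distr_r. Qed.

Definition real_restriction : ModuleSpace R_Ring :=
  ModuleSpace.Pack R_Ring E
    (ModuleSpace.Class R_Ring E (AbelianGroup.class E)
      (ModuleSpace.Mixin R_Ring E real_scal real_scal_assoc real_scal_one
        real_scal_distr_l real_scal_distr_r)) E.

End RealRestriction.

(** * Linear maps and their [sup_norm] *)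

Section SupNorm.
Context (K : scalars) (E F : Banach K).

Lemma sup_norm_le (f : E -> F) M :
  0 <= M -> (forall x, norm x <= 1 -> norm (f x) <= M) -> sup_norm f <= M.
Proof.
move=> M0 HM; rewrite /sup_norm /Lub_Rbar; case: ex_lub_Rbar => l [ub lub] /=.
have HM' : Rbar_le l M by apply: lub => _ [x [x1 ->]]; apply: HM.
by case: l HM' {ub lub}.
Qed.

(** Unbounded maps are covered too, because [real] sends an infinite supremum to 0. *)
Lemma sup_norm_ge0 (f : E -> F) : 0 <= sup_norm f.
Proof.
rewrite /sup_norm /Lub_Rbar; case: ex_lub_Rbar => l [ub _] /=.
have H : Rbar_le (norm (f zero)) l.
  apply: ub; exists zero; split=> //.
  by rewrite (@norm_zero _ E); apply: Rle_0_1.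
case: l H {ub} => [l||] /= H; try exact: Rle_refl.
exact: Rle_trans (norm_ge_0 _) H.
Qed.

(** Linearity makes the supremum finite, so it bounds the values on the ball; other vectors of
    nonzero norm are rescaled to norm one. *)
Lemma sup_norm_ge (f : E -> F) (x : E) :
  is_linear f -> norm (f x) <= sup_norm f * norm x.
Proof.
move=> lf.
have unit u : norm u <= 1 -> norm (f u) <= sup_norm f.
  move=> u1; rewrite /sup_norm /Lub_Rbar; case: ex_lub_Rbar => l [ub lub] /=.
  have Hu : Rbar_le (norm (f u)) l by apply: ub; exists u.
  case: (linear_norm _ lf) => M [M0 HM].
  have HM' : Rbar_le l M.
    apply: lub => _ [z [z1 ->]]; apply: Rle_trans (HM z) _.
    by rewrite -[X in _ <= X]Rmult_1_r; apply: Rmult_le_compat_l => //; lra.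
  by case: l Hu HM' {ub lub}.
case: (Rle_lt_or_eq_dec _ _ (norm_ge_0 x)) => [x0|x0]; last first.
  case: (linear_norm _ lf) => M [_ /(_ x)].
  by rewrite -x0 !Rmult_0_r.
have nx : norm x <> 0 by lra.
have ix0 := Rinv_0_lt_compat _ x0.
have := unit (scal (of_real K (/ norm x)) x).
rewrite (linear_scal _ lf) => H.
have {}H : norm (scal (of_real K (/ norm x)) (f x)) <= sup_norm f.
  apply: H; apply: Rle_trans (norm_scal _ _) _.
  by rewrite abs_of_real Rabs_pos_eq ?Rinv_l //; lra.
have {1}-> : f x = scal (of_real K (norm x)) (scal (of_real K (/ norm x)) (f x)).
  by rewrite scal_assoc -of_real_mult Rinv_r // of_real_1 scal_one.
apply: Rle_trans (norm_scal _ _) _; rewrite abs_of_real Rabs_pos_eq; last lra.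
by rewrite Rmult_comm; apply: Rmult_le_compat_r H; lra.
Qed.

End SupNorm.

Lemma is_linear_of_bound (K : scalars) (E F : Banach K) (f : E -> F) M :
  0 <= M ->
  (forall x y, f (plus x y) = plus (f x) (f y)) ->
  (forall a x, f (scal a x) = scal a (f x)) ->
  (forall x, norm (f x) <= M * norm x) ->
  is_linear f /\ sup_norm f <= M.
Proof.
move=> M0 fplus fscal fM; split.
  (* [is_linear] asks for a strictly positive constant, whereas [M] may be 0. *)
  split=> //; exists (M + 1); split=> [|x]; first lra.
  apply: Rle_trans (fM x) _; apply: Rmult_le_compat_r; last lra.
  exact: norm_ge_0.
apply: sup_norm_le => // x x1; apply: Rle_trans (fM x) _.
by rewrite -[X in _ <= X]Rmult_1_r; apply: Rmult_le_compat_l.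
Qed.

(** * Norming functionals over both fields, and the canonical injection *)

(** The pair [(u, v)] is the conjugate of [z] divided by its modulus, or 1 if [z] is zero; its
    product with [z] has real part [Cmod z]. *)
Lemma Cmod_rotate (z : C) :
  exists u v : R, Cmod (u, v) = 1 /\ u * fst z - v * snd z = Cmod z.
Proof.
case: (Req_dec (Cmod z) 0) => [z0|nz].
  exists 1, 0; rewrite (Cmod_eq_0 _ z0) Cmod_0 (Cmod_R 1) Rabs_R1; split=> //=; ring.
have sq : Cmod z * Cmod z = fst z * fst z + snd z * snd z.
  rewrite {1 2}/Cmod sqrt_sqrt; first by ring.
  by apply: Rplus_le_le_0_compat; apply: pow2_ge_0.
exists (fst z / Cmod z), (- (snd z / Cmod z)); split.
  rewrite {1}/Cmod (_ : _ + _ = 1) ?sqrt_1 //.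
  transitivity ((fst z * fst z + snd z * snd z) / (Cmod z * Cmod z)).
    by rewrite /=; field.
  by rewrite -sq; field.
transitivity ((fst z * fst z + snd z * snd z) / Cmod z); first by field.
by rewrite -sq; field.
Qed.

Lemma complex_functional_of_real_part (E : Banach ComplexScalars) (f : E -> R) :
  (forall x y, f (plus x y) = f x + f y) ->
  (forall (a : R) x, f (scal (RtoC a : ComplexScalars) x) = a * f x) ->
  (forall x, Rabs (f x) <= norm x) ->
  exists phi : E -> line ComplexScalars,
    is_linear phi /\ sup_norm phi <= 1 /\ forall x, f x = fst (phi x : C).
Proof.
move=> fplus fscal fle.
(* The functional with real part [f] is [f x - i f (i x)]. *)
pose phi (x : E) : line ComplexScalars :=
  (f x, - f (scal (Ci : ComplexScalars) x)).
have phi_plus x y : phi (plus x y) = plus (phi x) (phi y).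
  rewrite /phi scal_distr_l !fplus Ropp_plus_distr //.
have f_scal a b x : f (scal ((a, b) : ComplexScalars) x) =
    a * f x + b * f (scal (Ci : ComplexScalars) x).
  have -> : ((a, b) : ComplexScalars) =
      plus (RtoC a : ComplexScalars) (mult (RtoC b : ComplexScalars) Ci).
    rewrite /plus /mult /= /Cplus /Cmult /=; congr pair; ring.
  by rewrite scal_distr_r fplus -scal_assoc !fscal.
have phi_scal a x : phi (scal a x) = scal a (phi x).
  case: a => a b; rewrite /phi (scal_assoc (Ci : ComplexScalars)).
  rewrite (_ : mult (Ci : ComplexScalars) _ = ((- b, a) : ComplexScalars)).
    rewrite (f_scal a b) (f_scal (- b) a) /scal /= /mult /= /Cmult /=.
    congr pair; ring.
  rewrite /mult /= /Cmult /=; congr pair; ring.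
(* Rotating [x] by a unimodular scalar turns the modulus of [phi x] into a value of [f]. *)
have phi_le x : norm (phi x) <= norm x.
  have [u [v [uv1 uv]]] := Cmod_rotate (phi x).
  have : Rabs (f (scal ((u, v) : ComplexScalars) x)) <= norm x.
    apply: Rle_trans (fle _) _; apply: Rle_trans (norm_scal _ _) _.
    by rewrite -[X in _ <= X]Rmult_1_l; right; congr Rmult.
  rewrite f_scal; apply: Rle_trans; right.
  rewrite (_ : u * _ + _ = Cmod (phi x)); last by rewrite -uv /phi /=; ring.
  by rewrite Rabs_pos_eq //; apply: Cmod_ge_0.
have [lphi nphi] := is_linear_of_bound Rle_0_1 phi_plus phi_scal
  (fun x => Rle_trans _ _ _ (phi_le x) (Req_le _ _ (esym (Rmult_1_l _)))).
by exists phi.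
Qed.

(** Hahn-Banach over the reals gives [f] with [f y = norm y]. Over the complex field [f] becomes the
    real part of [phi], and the modulus dominates the real part. *)
Lemma norming_functional (K : scalars) (F : Banach K) (y : F) :
  exists phi : dual_ball F, norm y <= abs (proj1_sig phi y : K).
Proof.
have [|||f [fplus [fscal [fy fle]]]] :=
  @hahn_banach_real (real_restriction F) norm y.
- exact: norm_ge_0.
- exact: norm_triangle.
- by move=> a x; apply: Rle_trans (norm_scal _ _) _; rewrite abs_of_real; right.
case: K F y f fplus fscal fy fle => F y f fplus fscal fy fle.
  have [] := @is_linear_of_bound RealScalars F (line RealScalars) f 1 Rle_0_1
    fplus fscal.
    by move=> x; rewrite Rmult_1_l; apply: fle.
  move=> lf nf; exists (exist _ f (conj lf nf)) => /=.
  by rewrite -fy; apply: Rle_abs.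
have [phi [lphi [nphi phif]]] := complex_functional_of_real_part fplus fscal fle.
exists (exist _ phi (conj lphi nphi)) => /=; rewrite -fy phif.
apply: Rle_trans (Rle_abs _) _; apply: Rle_trans (Rmax_l _ _) (Rmax_Cmod _).
Qed.

Lemma canonical_inj_norm (K : scalars) (F : Banach K) (y : F) :
  norm (canonical_inj y) = norm y.
Proof.
apply: Rle_antisym.
  by apply: linf_norm_le => [|phi]; [apply: norm_ge_0 | apply: dual_ball_le].
case: (norming_functional y) => phi; move/Rle_trans; apply.
exact: (linf_norm_ge (canonical_inj y) phi).
Qed.

Lemma canonical_inj_plus (K : scalars) (F : Banach K) (x y : F) :
  canonical_inj (plus x y) = plus (canonical_inj x) (canonical_inj y).
Proof. by apply: linf_ext => -[phi [lphi nphi]]; apply: linear_plus lphi _ _. Qed.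

Lemma canonical_inj_scal (K : scalars) (F : Banach K) (a : K) (x : F) :
  canonical_inj (scal a x) = scal a (canonical_inj x).
Proof. by apply: linf_ext => -[phi [lphi nphi]]; apply: linear_scal lphi _ _. Qed.

Lemma canonical_inj_linear_sup (K : scalars) (F : Banach K) :
  is_linear (@canonical_inj K F) /\ sup_norm (@canonical_inj K F) <= 1.
Proof.
apply: is_linear_of_bound Rle_0_1 _ _ _.
- exact: canonical_inj_plus.
- exact: canonical_inj_scal.
- by move=> x; rewrite canonical_inj_norm Rmult_1_l; apply: Rle_refl.
Qed.

Lemma canonical_inj_linear (K : scalars) (F : Banach K) :
  is_linear (@canonical_inj K F).
Proof. exact: (proj1 (canonical_inj_linear_sup F)). Qed.

Lemma canonical_inj_minus (K : scalars) (F : Banach K) (x y : F) :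
  canonical_inj (minus x y) = minus (canonical_inj x) (canonical_inj y).
Proof. exact: linear_minus (canonical_inj_linear F). Qed.

Lemma canonical_inj_injective (K : scalars) (F : Banach K) (x y : F) :
  canonical_inj x = canonical_inj y -> x = y.
Proof.
move=> xy; apply: (plus_reg_r (opp y)); rewrite plus_opp_r.
apply: norm_eq_zero; rewrite -canonical_inj_norm canonical_inj_minus xy.
by rewrite minus_eq_zero norm_zero.
Qed.

(* [L] need not be continuous: [multilinear] is a purely algebraic condition. *)
Lemma canonical_inj_left_inverse (K : scalars) (F : Banach K) :
  exists L : linf_dual F -> F,
    (forall f g, L (plus f g) = plus (L f) (L g)) /\
    (forall a f, L (scal a f) = scal a (L f)) /\
    forall y, L (canonical_inj y) = y.
Proof.
(* For a subspace, [D] is just single-valuedness, without any bound; [G0] is the inverse of the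
   injection. *)
pose D (p : linf_dual F * F) := fst p = zero -> snd p = zero.
pose G0 (p : linf_dual F * F) := fst p = canonical_inj (snd p).
have lI := canonical_inj_linear F.
case: (@linear_extension K (linf_dual F) F D G0).
- by move=> w; apply.
- split.
  + exact: esym (linear_zero _ lI).
  + move=> [f x] [g y]; rewrite /G0 /= => -> ->.
    exact: esym (linear_plus _ lI _ _).
  + move=> a [f x]; rewrite /G0 /= => ->.
    exact: esym (linear_scal _ lI _ _).
- move=> [f x]; rewrite /G0 /D /= => -> H; apply: canonical_inj_injective.
  by rewrite H (linear_zero _ lI).
- move=> G v sG GD.
  case: (excluded_middle_informative (exists w, G (v, w))) => [[w Gw]|nG].
    exists w => p a Gp; apply: GD; apply: subspace_plus => //.
    exact: subspace_scal.
  (* Outside the domain any value would do: a nonzero [a] in a pair violating [D] would put [v] in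
     the domain. *)
  exists zero => -[x w] a Gp; rewrite /D /= => H.
  have a0 : a = zero.
    apply: NNPP => /scalar_inv [b ba]; apply: nG; exists (scal (opp b) w).
    have := subspace_scal sG (opp b) Gp.
    rewrite (_ : scal (opp b) (x, w) = (v, scal (opp b) w)) //.
    rewrite {1}/scal /= /prod_scal /=; congr pair.
    have -> : x = opp (scal a v).
      by apply: (plus_reg_r (scal a v)); rewrite plus_opp_l.
    by rewrite scal_opp_r scal_opp_l opp_opp scal_assoc ba scal_one.
  move: H; rewrite a0 scal_zero_l !scal_zero_r !plus_zero_r.
  by move/(GD _ Gp).
move=> L [Lplus [Lscal [LG _]]]; exists L; split=> //; split=> //.
by move=> y; apply: (LG (canonical_inj y, y)).
Qed.

(** * Continuous homogeneous polynomials *)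

Lemma hpoly_linear_comp (K : scalars) (E F G : Banach K) m (t : F -> G)
    (P : E -> F) :
  is_linear t -> hpoly m P -> hpoly m (fun x => t (P x)).
Proof.
move=> lt [[A [mA PA]] cP]; split.
  exists (fun x => t (A x)); split=> [x i a u v|x]; last by rewrite PA.
  by rewrite mA (linear_plus _ lt) (linear_scal _ lt).
move=> x; apply: continuous_comp (cP x) _; exact: linear_cont.
Qed.

(** To remove the injection, a linear left inverse carries the multilinear map back, while
    continuity follows from the isometry. *)
Lemma hpoly_canonical_inj (K : scalars) (E F : Banach K) m (P : E -> F) :
  hpoly m (fun x => canonical_inj (P x)) <-> hpoly m P.
Proof.
split; last exact/hpoly_linear_comp/canonical_inj_linear.
move=> [[A [mA PA]] cP].
case: (canonical_inj_left_inverse F) => L [Lplus [Lscal LI]]; split.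
  exists (fun x => L (A x)); split=> [x i a u v|x]; last by rewrite -PA LI.
  by rewrite mA Lplus Lscal.
move=> x; apply/filterlim_locally_ball_norm => eps.
have /filterlim_locally_ball_norm /(_ eps) := cP x.
apply: filter_imp => y; rewrite /ball_norm -canonical_inj_minus.
by rewrite canonical_inj_norm.
Qed.

Lemma hpoly_linear (K : scalars) (E F : Banach K) (u : E -> F) :
  is_linear u -> hpoly 1 u.
Proof.
move=> lu; split; last by move=> x; apply: linear_cont.
exists (fun x => u (x ord0)); split=> // x i a v w.
by rewrite /update (ord1 i) eqxx (linear_plus _ lu) (linear_scal _ lu).
Qed.

Lemma hpoly_homogeneous (K : scalars) (E F : Banach K) m (P : E -> F) a x :
  hpoly m P -> P (scal a x) = scal (pow_n a m) (P x).
Proof.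
move=> [[A [mA PA]] _]; rewrite !PA.
have Ascal (z : 'I_m -> E) i u :
    A (update z i (scal a u)) = scal a (A (update z i u)).
  have A0 : A (update z i zero) = zero.
    have := mA z i one zero zero; rewrite scal_zero_r plus_zero_r scal_one => H.
    by apply: (plus_reg_l (A (update z i zero))); rewrite plus_zero_r -H.
  by have := mA z i a u zero; rewrite A0 !plus_zero_r.
(* The arguments are scaled one at a time; passing from [k] to [k.+1] extracts one factor [a]. *)
pose z k (j : 'I_m) := if (j < k)%N then scal a x else x.
have H k : (k <= m)%N -> A (z k) = scal (pow_n a k) (A (fun _ => x)).
  elim: k => [|k IH] km.
    by rewrite scal_one; congr A; apply: functional_extensionality.
  pose i := Ordinal km.
  have zS : z k.+1 = update (z k) i (scal a x).
    apply: functional_extensionality => j; rewrite /z /update ltnS leq_eqVlt.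
    by rewrite -(inj_eq val_inj j i) /=; case: (nat_of_ord j == k).
  have zk : z k = update (z k) i x.
    apply: functional_extensionality => j; rewrite /z /update.
    rewrite -(inj_eq val_inj j i) /=; case: eqP => // ->; by rewrite ltnn.
  by rewrite zS Ascal -zk IH ?(ltnW km) // scal_assoc.
rewrite -H //; congr A; apply: functional_extensionality => j.
by rewrite /z ltn_ord.
Qed.

(** * Operators between spaces of bounded functions *)

(** Common form of the lift of an operator, where [s] pulls functionals back, and of the retraction,
    where [s] sends a point to its evaluation. *)
Lemma weighted_composition (K : scalars) (S T : Type) (a : K) (s : T -> S) :
  exists L : linf_CompleteNormedModule K S -> linf_CompleteNormedModule K T,
    is_linear L /\ sup_norm L <= abs a /\
    forall f t, linf_val (L f) t = mult a (linf_val f (s t)).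
Proof.
have bnd (f : linf K S) : exists M, forall t, abs (mult a (f (s t))) <= M.
  exists (abs a * linf_norm f) => t; apply: Rle_trans (abs_mult _ _) _.
  by apply: Rmult_le_compat_l (abs_ge_0 _) _; apply: linf_norm_ge.
pose L (f : linf K S) : linf K T := exist _ _ (bnd f).
have [] := @is_linear_of_bound K (linf_CompleteNormedModule K S)
  (linf_CompleteNormedModule K T) L (abs a) (abs_ge_0 _).
- by move=> f g; apply: linf_ext => t; apply: mult_distr_l.
- move=> b f; apply: linf_ext => t.
  change (mult a (mult b (linf_val f (s t))) = mult b (mult a (linf_val f (s t)))).
  by rewrite !mult_assoc (scalar_mult_comm a).
- move=> f; apply: linf_norm_le => [|t].
    by apply: Rmult_le_pos (abs_ge_0 _) _; apply: linf_norm_ge0.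
  apply: Rle_trans (abs_mult _ _) _.
  by apply: Rmult_le_compat_l (abs_ge_0 _) _; apply: linf_norm_ge.
by move=> lL nL; exists L.
Qed.

Lemma evaluation_functional (K : scalars) (S : Type) (s : S) :
  exists phi : dual_ball (linf_CompleteNormedModule K S),
    forall f, proj1_sig phi f = linf_val f s.
Proof.
have [] := @is_linear_of_bound K (linf_CompleteNormedModule K S) (line K)
  (fun f => linf_val f s) 1 Rle_0_1 => //.
  by move=> f; rewrite Rmult_1_l; apply: linf_norm_ge.
by move=> l n; exists (exist (fun phi => is_linear phi /\ sup_norm phi <= 1) _
    (conj l n)).
Qed.

(* If [c = 0] then [/ c = 0] and [t = 0], so the formula remains valid. *)
Lemma canonical_inj_lift (K : scalars) (G H : Banach K) (t : G -> H) :
  is_linear t ->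
  exists L : linf_dual G -> linf_dual H,
    is_linear L /\ sup_norm L <= sup_norm t /\
    forall y, L (canonical_inj y) = canonical_inj (t y).
Proof.
move=> lt; pose c := sup_norm t; have c0 : 0 <= c := sup_norm_ge0 t.
have pull (psi : dual_ball H) : exists phi : dual_ball G,
    forall y, proj1_sig phi y = mult (of_real K (/ c)) (proj1_sig psi (t y) : K).
  have lpsi := proj1 (proj2_sig psi).
  have [] := @is_linear_of_bound K G (line K) (fun y =>
    mult (of_real K (/ c)) (proj1_sig psi (t y) : K)) 1 Rle_0_1.
  - move=> x y; rewrite (linear_plus _ lt) (linear_plus _ lpsi).
    exact: mult_distr_l.
  - move=> a x; rewrite (linear_scal _ lt) (linear_scal _ lpsi).
    change (mult (of_real K (/ c)) (mult a (proj1_sig psi (t x) : K)) =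
      mult a (mult (of_real K (/ c)) (proj1_sig psi (t x) : K))).
    by rewrite !mult_assoc (scalar_mult_comm a).
  - move=> x; apply: Rle_trans (abs_mult _ _) _.
    have tx : abs (proj1_sig psi (t x) : K) <= c * norm x.
      exact: Rle_trans (dual_ball_le _ _) (sup_norm_ge x lt).
    apply: Rle_trans (Rmult_le_compat_l _ _ _ (abs_ge_0 _) tx) _.
    rewrite abs_of_real -Rmult_assoc.
    apply: Rmult_le_compat_r; first exact: norm_ge_0.
    case: c0 => [c0|<-]; last by rewrite Rmult_0_r; apply: Rle_0_1.
    have ic0 := Rinv_0_lt_compat _ c0.
    by rewrite Rabs_pos_eq ?Rinv_l; lra.
  by move=> l n; exists (exist (fun phi => is_linear phi /\ sup_norm phi <= 1) _
    (conj l n)).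
pose s psi := proj1_sig (constructive_indefinite_description _ (pull psi)).
have [L [lL [nL LE]]] := weighted_composition (of_real K c) s.
exists L; split=> //; split=> [|y].
  by move: nL; rewrite abs_of_real Rabs_pos_eq.
apply: linf_ext => psi; rewrite LE.
rewrite /canonical_inj /= /s; case: constructive_indefinite_description => phi /= ->.
rewrite mult_assoc -of_real_mult.
case: c0 => [c0|c0].
  by rewrite Rinv_r ?of_real_1 ?mult_one_l //; lra.
have -> : t y = zero.
  apply: norm_eq_zero; apply: Rle_antisym (norm_ge_0 _).
  by have := sup_norm_ge y lt; rewrite -/c -c0 Rmult_0_l.
by rewrite (linear_zero _ (proj1 (proj2_sig psi))) mult_zero_r.
Qed.

(** Evaluations send [S] into the dual ball, and [L] is composition with this map. *)
Lemma canonical_inj_linf_retraction (K : scalars) (S : Type) :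
  exists L : linf_dual (linf_CompleteNormedModule K S) ->
      linf_CompleteNormedModule K S,
    is_linear L /\ sup_norm L <= 1 /\ forall f, L (canonical_inj f) = f.
Proof.
pose s x := proj1_sig (constructive_indefinite_description _
  (@evaluation_functional K S x)).
have [L [lL [nL LE]]] := weighted_composition (one : K) s.
exists L; split=> //; split=> [|f]; first by move: nL; rewrite abs_one.
apply: linf_ext => x; rewrite LE mult_one_l /s /=.
by case: constructive_indefinite_description.
Qed.

(** The identity of [line K] is a point of its dual ball, and [L] evaluates at this point. *)
Lemma canonical_inj_line_retraction (K : scalars) :
  exists L : linf_dual (line K) -> line K,
    is_linear L /\ sup_norm L <= 1 /\ forall a, L (canonical_inj a) = a.
Proof.
have [|||l n] := @is_linear_of_bound K (line K) (line K) id 1 Rle_0_1 => //.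
  by move=> x; rewrite Rmult_1_l; apply: Rle_refl.
pose phi : dual_ball (line K) := exist _ id (conj l n).
have [] := @is_linear_of_bound K (linf_dual (line K)) (line K)
  (fun f => linf_val f phi) 1 Rle_0_1 => //.
  by move=> f; rewrite Rmult_1_l; apply: linf_norm_ge.
by move=> lL nL; exists (fun f => linf_val f phi).
Qed.

(** Equality fails on the zero space, where the supremum is 0. *)
Lemma sup_norm_id (K : scalars) (E : Banach K) : sup_norm (fun x : E => x) <= 1.
Proof. by apply: sup_norm_le => //; apply: Rle_0_1. Qed.

(** * The hull as a polynomial ideal or hyper-ideal *)

(** The degree [k] recorded in [inj_hull] may differ from [m], but membership in [Q] does not
    mention a degree, and [hpoly] is transferred at degree [m]. *)
Lemma component_inj_hull (K : scalars) (Q : poly_class K) m (E F : Banach K)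
    (P : E -> F) :
  (0 < m)%N ->
  component (inj_hull Q) m P <-> component Q m (fun x => canonical_inj (P x)).
Proof.
move=> m0; split=> [[hP [k [_ [_ [_ QP]]]]]|[hP QP]].
  by split=> //; apply/hpoly_canonical_inj.
by have hP' := proj1 (hpoly_canonical_inj m P) hP; split=> //; exists m.
Qed.

Lemma eq_component (K : scalars) (Q : poly_class K) m (E F : Banach K)
    (P P' : E -> F) :
  P =1 P' -> component Q m P -> component Q m P'.
Proof. by move=> /functional_extensionality ->. Qed.

(** Linearity of the injection settles the vector space conditions. In a composition, the lift
    replaces [t] by an operator to which the ideal property of [Q] applies. *)
Lemma inj_hull_polynomial_ideal (K : scalars) (Q : poly_class K) :
  polynomial_ideal Q -> polynomial_ideal (inj_hull Q).
Proof.
move=> iQ; split.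
- by move=> E F P [m [m0 [hP _]]]; exists m.
- move=> m E F m0; apply/component_inj_hull => //.
  rewrite (linear_zero _ (canonical_inj_linear F)).
  exact: ideal_zero.
- move=> m E F P1 P2 m0 /component_inj_hull c1 /component_inj_hull c2.
  apply/component_inj_hull => //.
  apply: eq_component (ideal_plus iQ m0 (c1 m0) (c2 m0)) => x.
  by rewrite canonical_inj_plus.
- move=> m E F a P m0 /component_inj_hull c; apply/component_inj_hull => //.
  apply: eq_component (ideal_scal iQ a m0 (c m0)) => x.
  by rewrite canonical_inj_scal.
- move=> m E F P m0 /(ideal_finite_type iQ m0) c; apply/component_inj_hull => //.
  apply: (ideal_comp iQ m0 (canonical_inj_linear F) c (u := id)).
  exact: is_linear_id.
- move=> m E F G H t P u m0 lt /component_inj_hull c lu.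
  apply/component_inj_hull => //.
  have [L [lL [_ LI]]] := canonical_inj_lift lt.
  by apply: eq_component (ideal_comp iQ m0 lL (c m0) lu) => x; rewrite LI.
Qed.

Lemma inj_hull_polynomial_hyper_ideal (K : scalars) (Q : poly_class K) :
  polynomial_hyper_ideal Q -> polynomial_hyper_ideal (inj_hull Q).
Proof.
move=> [iQ hQ]; split; first exact: inj_hull_polynomial_ideal.
move=> m n E F G H t P S m0 n0 lt /component_inj_hull c hS.
have mn0 : (0 < m * n)%N by rewrite muln_gt0 m0.
apply/component_inj_hull => //.
have [L [lL [_ LI]]] := canonical_inj_lift lt.
by apply: eq_component (hQ _ _ _ _ _ _ _ _ _ m0 n0 lL (c m0) hS) => x; rewrite LI.
Qed.

(** A bounded operator is a polynomial of degree 1, so the ideal inequality is the hyper-ideal one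
    with inner degree 1. *)
Lemma normed_polynomial_hyper_ideal_normed (K : scalars) (Q : poly_class K)
    (N : poly_norm K) :
  normed_polynomial_hyper_ideal Q N -> normed_polynomial_ideal Q N.
Proof.
move=> [[iQ _] [nN hN]]; split=> //; split=> // m E F G H t P u m0 lt c lu.
by apply: (hN m 1%N) => //; apply: hpoly_linear.
Qed.

Lemma is_ideal_of_kind_normed (K : scalars) kind (Q : poly_class K)
    (N : poly_norm K) :
  is_ideal_of_kind kind Q N -> normed_polynomial_ideal Q N.
Proof.
case: kind => /=; [by []|by case| |case=> + _];
  exact: normed_polynomial_hyper_ideal_normed.
Qed.

(** * The norm of the hull *)

Section NormedIdeal.
Context (K : scalars) (Q : poly_class K) (N : poly_norm K).
Hypothesis hQ : normed_polynomial_ideal Q N.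

(** The ideal inequality with the identity as inner operator. Applied to an injection and to its
    retraction, it yields equalities of norms. *)
Lemma contraction_norm_le m (E F G : Banach K) (t : F -> G) (P : E -> F) :
  (0 < m)%N -> is_linear t -> sup_norm t <= 1 -> component Q m P ->
  N (fun x => t (P x)) <= N P.
Proof.
move=> m0 lt nt c; have [iQ [nN hN]] := hQ.
have P0 := ideal_norm_ge0 nN m0 c.
apply: Rle_trans (hN m E E F G t P id m0 lt c (@is_linear_id _ _)) _.
have := pow_incr _ 1 m (conj (sup_norm_ge0 (fun x : E => x)) (sup_norm_id E)).
rewrite pow1 => u1; have u0 := pow_le _ m (sup_norm_ge0 (fun x : E => x)).
rewrite -[X in _ <= X]Rmult_1_r; apply: Rmult_le_compat u1 => //.
  by apply: Rmult_le_pos => //; apply: sup_norm_ge0.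
by rewrite -[X in _ <= X]Rmult_1_l; apply: Rmult_le_compat_r.
Qed.

Lemma component_linear_comp m (E F G : Banach K) (t : F -> G) (P : E -> F) :
  (0 < m)%N -> is_linear t -> component Q m P -> component Q m (fun x => t (P x)).
Proof.
move=> m0 lt c; have [iQ _] := hQ.
exact: (ideal_comp iQ m0 lt c (@is_linear_id _ _)).
Qed.

Lemma component_power m :
  (0 < m)%N -> component Q m (fun a : line K => pow_n (a : K) m : line K).
Proof.
move=> m0; have [iQ _] := hQ; apply: (ideal_finite_type iQ) => //.
(* [sum_n] includes its upper index, so 0 gives a single term. *)
exists 0%N, (fun _ => id), (fun _ => one : line K); split.
  by move=> _; apply: is_linear_id.
by move=> a; rewrite sum_O; apply/esym/mult_one_r.
Qed.

Lemma inj_norm_ideal_norm : ideal_norm (inj_hull Q) (inj_norm N).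
Proof.
have [iQ [nN hN]] := hQ; split.
- move=> m E F P m0 /component_inj_hull c.
  exact: (ideal_norm_ge0 nN m0 (c m0)).
- move=> m E F P m0 /component_inj_hull c P0 x; apply: canonical_inj_injective.
  rewrite (ideal_norm_eq0 nN m0 (c m0) P0).
  exact: esym (linear_zero _ (canonical_inj_linear F)).
- move=> m E F a P m0 /component_inj_hull c; rewrite /inj_norm.
  rewrite -(ideal_norm_scal nN a m0 (c m0)); congr N.
  by apply: functional_extensionality => x; apply: canonical_inj_scal.
- move=> m E F P1 P2 m0 /component_inj_hull c1 /component_inj_hull c2.
  rewrite /inj_norm.
  apply: Rle_trans (ideal_norm_triangle nN m0 (c1 m0) (c2 m0)); right; congr N.
  by apply: functional_extensionality => x; apply: canonical_inj_plus.
(* The injection of the line and its retraction are both contractions, so the power keeps its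
   norm. *)
- move=> m m0; rewrite /inj_norm -(ideal_norm_power nN m0).
  have [lI nI] := canonical_inj_linear_sup (line K).
  have c := component_power m0.
  apply: Rle_antisym; first exact: (contraction_norm_le m0 lI nI c).
  have [L [lL [nL LI]]] := canonical_inj_line_retraction K.
  have := contraction_norm_le m0 lL nL (component_linear_comp m0 lI c).
  apply: Rle_trans; right; congr N.
  by apply: functional_extensionality => a; rewrite LI.
Qed.

Lemma inj_hull_normed_polynomial_ideal :
  normed_polynomial_ideal (inj_hull Q) (inj_norm N).
Proof.
have [iQ [nN hN]] := hQ.
split; first exact: inj_hull_polynomial_ideal.
split; first exact: inj_norm_ideal_norm.
move=> m E F G H t P u m0 lt /component_inj_hull c lu.
have [L [lL [nL LI]]] := canonical_inj_lift lt.
have P0 := ideal_norm_ge0 nN m0 (c m0).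
have u0 := pow_le _ m (sup_norm_ge0 u).
apply: Rle_trans (Rmult_le_compat_r _ _ _ u0 (Rmult_le_compat_r _ _ _ P0 nL)).
apply: Rle_trans (hN _ _ _ _ _ _ _ _ m0 lL (c m0) lu); right; congr N.
by apply: functional_extensionality => x; rewrite LI.
Qed.

(** Evaluation at [s] and the operator [a => scal a x] reduce [P] to a multiple of a power map,
    whose norm is known. This turns convergence in [N] into pointwise convergence. *)
Lemma norm_component_le m (E : Banach K) S
    (P : E -> linf_CompleteNormedModule K S) x :
  (0 < m)%N -> component Q m P -> norm (P x) <= N P * norm x ^ m.
Proof.
move=> m0 c; have [iQ [nN hN]] := hQ.
have P0 := ideal_norm_ge0 nN m0 c.
have x0 := pow_le _ m (norm_ge_0 x).
apply: linf_norm_le => [|s]; first exact: Rmult_le_pos.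
have [[phi [lphi nphi]] /= phiE] := evaluation_functional K s.
have [||| lu nu] := @is_linear_of_bound K (line K) E (fun a => scal (a : K) x)
  (norm x) (norm_ge_0 _).
- by move=> a b; apply: scal_distr_r.
- by move=> a b; rewrite scal_assoc.
- by move=> a; rewrite Rmult_comm; apply: norm_scal.
have := hN _ _ _ _ _ _ _ _ m0 lphi c lu.
have -> : (fun a : line K => phi (P (scal (a : K) x))) =
    fun a => scal (linf_val (P x) s) (pow_n (a : K) m : line K).
  apply: functional_extensionality => a.
  rewrite (hpoly_homogeneous _ _ (proj1 c)) phiE.
  exact: scalar_mult_comm.
rewrite (ideal_norm_scal nN _ m0 (component_power m0)) (ideal_norm_power nN m0).
rewrite Rmult_1_r; move/Rle_trans; apply.
apply: Rmult_le_compat.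
- by apply: Rmult_le_pos => //; apply: sup_norm_ge0.
- by apply: pow_le; apply: sup_norm_ge0.
- by rewrite -[X in _ <= X]Rmult_1_l; apply: Rmult_le_compat_r.
- by apply: pow_incr; split=> //; apply: sup_norm_ge0.
Qed.

Lemma component_minus m (E F : Banach K) (P1 P2 : E -> F) :
  (0 < m)%N -> component Q m P1 -> component Q m P2 ->
  component Q m (fun x => minus (P1 x) (P2 x)).
Proof.
move=> m0 c1 c2; have [iQ _] := hQ.
apply: eq_component (ideal_plus iQ m0 c1 (ideal_scal iQ (opp one) m0 c2)) => x.
by rewrite scal_opp_one.
Qed.

End NormedIdeal.

(** * Completeness of the components *)

(** The sequence [y] is Cauchy because the injection is isometric; the image of its limit is [f] by
    uniqueness of limits. *)
Lemma closed_range_canonical_inj (K : scalars) (F : Banach K) (y : nat -> F)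
    (f : linf_dual F) :
  (forall eps : posreal,
     eventually (fun i => norm (minus (canonical_inj (y i)) f) < eps)) ->
  exists z, canonical_inj z = f.
Proof.
move=> yf.
have [|z yz] := proj1 (@filterlim_locally_cauchy nat F eventually _ y).
  move=> eps; exists (fun i => norm (minus (canonical_inj (y i)) f) < eps / 2).
  split; first exact: (yf (pos_div_2 eps)).
  move=> i j Hi Hj; apply: norm_compat1.
  rewrite -canonical_inj_norm canonical_inj_minus (minus_trans f).
  apply: Rle_lt_trans (norm_triangle _ _) _.
  rewrite -(Rplus_half_diag eps); apply: Rplus_lt_compat Hj _.
  by rewrite -norm_opp opp_minus.
exists z; apply: (@filterlim_locally_unique nat K _ eventually _
  (fun i => canonical_inj (y i))).
  exact: filterlim_comp yz (linear_cont _ z (canonical_inj_linear F)).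
apply/filterlim_locally_ball_norm => eps; exact: (yf eps).
Qed.

Lemma inj_hull_complete (K : scalars) (Q : poly_class K) (N : poly_norm K) :
  normed_polynomial_ideal Q N -> complete_components Q N ->
  complete_components (inj_hull Q) (inj_norm N).
Proof.
move=> hQ cQ m E F P m0 cP Pcauchy.
pose IP i x := canonical_inj (P i x).
have cIP i : component Q m (IP i) by apply/component_inj_hull.
have [eps|R0 [cR0 limR0]] := cQ m E (linf_dual F) IP m0 cIP.
  have [i0 Hi0] := Pcauchy eps; exists i0 => i j Hi Hj.
  have := Hi0 i j Hi Hj; rewrite /inj_norm; apply: Rle_lt_trans; right; congr N.
  by apply: functional_extensionality => x; rewrite canonical_inj_minus.
(* At a fixed [x], the distance from [IP i x] to [R0 x] is at most the [N]-norm of the difference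
   times [norm x ^ m]. *)
have range x : exists y, canonical_inj y = R0 x.
  apply: (@closed_range_canonical_inj _ _ (fun i => P i x)) => eps.
  have := is_lim_seq_scal_r _ (norm x ^ m) _ limR0.
  rewrite /= Rmult_0_l => /is_lim_seq_spec /(_ eps).
  case=> i0 Hi0; exists i0 => i /Hi0; rewrite Rminus_0_r; apply: Rle_lt_trans.
  apply: Rle_trans (Rle_abs _).
  exact: (norm_component_le hQ x m0 (component_minus hQ m0 (cIP i) cR0)).
pose P0 x := proj1_sig (constructive_indefinite_description _ (range x)).
have IP0 : R0 = fun x => canonical_inj (P0 x).
  apply: functional_extensionality => x; rewrite /P0.
  by case: constructive_indefinite_description.
rewrite IP0 in cR0 limR0.
exists P0; split; first exact/component_inj_hull.
apply: is_lim_seq_ext limR0 => i; rewrite /inj_norm; congr N.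
by apply: functional_extensionality => x; rewrite canonical_inj_minus.
Qed.

(** * Normed hyper-ideals, the four kinds together, and comparison of hulls *)

Lemma inj_hull_normed_polynomial_hyper_ideal (K : scalars) (Q : poly_class K)
    (N : poly_norm K) :
  normed_polynomial_hyper_ideal Q N ->
  normed_polynomial_hyper_ideal (inj_hull Q) (inj_norm N).
Proof.
move=> hQ; have nQ := normed_polynomial_hyper_ideal_normed hQ.
have [iQ [nN hN]] := hQ.
split; first exact: inj_hull_polynomial_hyper_ideal.
split; first exact: inj_norm_ideal_norm.
move=> m n E F G H t P S m0 n0 lt /component_inj_hull c hS.
have [L [lL [nL LI]]] := canonical_inj_lift lt.
have P0 := ideal_norm_ge0 nN m0 (c m0).
have S0 := pow_le _ m (sup_norm_ge0 S).
apply: Rle_trans (Rmult_le_compat_r _ _ _ S0 (Rmult_le_compat_r _ _ _ P0 nL)).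
apply: Rle_trans (hN _ _ _ _ _ _ _ _ _ m0 n0 lL (c m0) hS); right; congr N.
by apply: functional_extensionality => x; rewrite LI.
Qed.

Lemma inj_hull_is_ideal_of_kind (K : scalars) kind (Q : poly_class K)
    (N : poly_norm K) :
  is_ideal_of_kind kind Q N -> is_ideal_of_kind kind (inj_hull Q) (inj_norm N).
Proof.
move=> hQ; have nQ := is_ideal_of_kind_normed hQ.
case: kind hQ => /= hQ.
- exact: inj_hull_normed_polynomial_ideal.
- split; first exact: inj_hull_normed_polynomial_ideal.
  exact: inj_hull_complete nQ (proj2 hQ).
- exact: inj_hull_normed_polynomial_hyper_ideal.
- split; first exact: inj_hull_normed_polynomial_hyper_ideal (proj1 hQ).
  exact: inj_hull_complete nQ (proj2 hQ).
Qed.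

Lemma inj_hull_mono (K : scalars) (Q R : poly_class K) :
  class_sub Q R -> class_sub (inj_hull Q) (inj_hull R).
Proof.
move=> QR E F P [m [m0 [hP [hIP /QR RP]]]].
by exists m; split=> //; split.
Qed.

Lemma sub_inj_hull (K : scalars) (Q : poly_class K) (N : poly_norm K) :
  normed_polynomial_ideal Q N ->
  class_sub Q (inj_hull Q) /\ norm_le_on Q (inj_norm N) N.
Proof.
move=> hQ; split=> E F P QP; have [m [m0 hP]] := ideal_hpoly (proj1 hQ) QP;
  have [lI nI] := canonical_inj_linear_sup F.
  exists m; split=> //; split=> //.
  exact: (component_linear_comp hQ m0 lI (conj hP QP)).
exact: (contraction_norm_le hQ m0 lI nI (conj hP QP)).
Qed.

(** One half is [sub_inj_hull] for the hull itself. For the other, [linf_dual F] is a space of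
    bounded functions, so its retraction removes the outer injection without increasing the norm. *)
Lemma inj_hull_idempotent (K : scalars) (Q : poly_class K) (N : poly_norm K) :
  normed_polynomial_ideal Q N ->
  class_eq (inj_hull (inj_hull Q)) (inj_hull Q) /\
  norm_eq_on (inj_hull Q) (inj_norm (inj_norm N)) (inj_norm N).
Proof.
move=> hQ; have [subI leI] := sub_inj_hull (inj_hull_normed_polynomial_ideal hQ).
split=> E F P.
  split; last exact: subI.
  move=> [m [m0 [hP /component_inj_hull c]]]; exists m; split=> //; split=> //.
  have [L [lL [nL LI]]] := @canonical_inj_linf_retraction K (dual_ball F).
  by apply: eq_component (component_linear_comp hQ m0 lL (c m0)) => x; apply: LI.
move=> QP; apply: Rle_antisym; first exact: leI.
have [m [m0 [_ c]]] := QP.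
have [L [lL [nL LI]]] := @canonical_inj_linf_retraction K (dual_ball F).
have := component_linear_comp hQ m0 (canonical_inj_linear (linf_dual F)) c.
move/(contraction_norm_le hQ m0 lL nL); apply: Rle_trans; right.
by rewrite /inj_norm; congr N; apply: functional_extensionality => x; rewrite LI.
Qed.

Theorem proposition2p5 (K : scalars) (kind : ideal_kind)
    (Q R : poly_class K) (NQ NR : poly_norm K)
    (hQ : is_ideal_of_kind kind Q NQ) (hR : is_ideal_of_kind kind R NR) :
  (* (a) *)
  is_ideal_of_kind kind (inj_hull Q) (inj_norm NQ) /\
  (* (b) *)
  (class_sub Q R -> norm_le_on Q NR NQ ->
     class_sub (inj_hull Q) (inj_hull R) /\
     norm_le_on (inj_hull Q) (inj_norm NR) (inj_norm NQ)) /\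
  (* (c) *)
  (class_eq (inj_hull (inj_hull Q)) (inj_hull Q) /\
   norm_eq_on (inj_hull Q) (inj_norm (inj_norm NQ)) (inj_norm NQ)) /\
  (* (d) *)
  (class_sub Q (inj_hull Q) /\ norm_le_on Q (inj_norm NQ) NQ).
Proof.
have nQ := is_ideal_of_kind_normed hQ.
split; first exact: inj_hull_is_ideal_of_kind.
split; last by split; [apply: inj_hull_idempotent|apply: sub_inj_hull].
move=> QR NQR; split; first exact: inj_hull_mono.
by move=> E F P [m [_ [_ [_ QP]]]]; apply: NQR.
Qed.
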